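(* Let $(X,u)$ be an ultrametric space with a countable partially ordered value set. Then its ball space $(X,\mathcal{B}_u)$ is chain union stable.
   Context: A ball space $(X,\mathcal{B})$ is a nonempty set $X$ together with a nonempty collection $\mathcal{B}$ of nonempty subsets of $X$ (called balls). A chain in $\mathcal{B}$ is a nonempty subset of $\mathcal{B}$ that is linearly ordered by inclusion. Define $\mathrm{cu}(\mathcal{B})=\{\bigcup\mathcal{C}\mid \emptyset\ne\mathcal{C}\subseteq\mathcal{B},\ \mathcal{C}\text{ is a chain}\}$. The ball space is chain union closed if $\mathrm{cu}(\mathcal{B})=\mathcal{B}$, and chain union stable if $(X,\mathrm{cu}(\mathcal{B}))$ is chain union closed. An ultrametric space $(X,u)$ with value set $\Gamma$ consists of a nonempty set $X$, a partially ordered set $\Gamma$ with smallest element $\bot$, and a function $u:X\times X\to\Gamma$ such that for all $x,y,z\in X$, $\gamma\in\Gamma$: (U1) $u(x,y)=\bot$ iff $x=y$; (U2) if $u(x,y)\le\gamma$ and $u(y,z)\le\gamma$ then $u(x,z)\le\gamma$; (U3) $u(x,y)=u(y,x)$. For $x,y\in X$, the (precise) ball is $B(x,y)=\{z\in X\mid u(x,z)\le u(x,y)\}$. The ultrametric ball space is $(X,\mathcal{B}_u)$ with $\mathcal{B}_u=\{B(x,y)\mid x,y\in X\}$. *)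

(* Defs.v *)
From mathcomp Require Import all_boot all_order.
From mathcomp Require Import boolp classical_sets functions cardinality.

Set Implicit Arguments.
Unset Strict Implicit.
Unset Printing Implicit Defensive.

Local Open Scope classical_set_scope.

(* Nonemptiness of [X] is not a separate field: it follows from the existence
   of a nonempty ball. *)
Record ball_space (X : Type) := BallSpace {
  balls : set (set X);
  balls_nonempty : balls !=set0;
  ball_nonempty : forall B, balls B -> B !=set0
}.

Definition chain (X : Type) (C : set (set X)) : Prop :=
  C !=set0 /\ total_on C subset.

Definition cu (X : Type) (S : set (set X)) : set (set X) :=
  [set \bigcup_(B in C) B | C in [set C | C `<=` S /\ chain C]].

Definition chain_union_closed (X : Type) (S : ball_space X) : Prop :=
  cu (balls S) = balls S.

Lemma cu_nonempty (X : Type) (S : ball_space X) : cu (balls S) !=set0.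
Proof.
have [B SB] := balls_nonempty S.
exists (\bigcup_(A in [set B]) A); exists [set B] => //; split.
  by move=> _ ->.
by split; [exists B | move=> _ _ -> ->; left].
Qed.

Lemma cu_ball_nonempty (X : Type) (S : ball_space X) (B : set X) :
  cu (balls S) B -> B !=set0.
Proof.
move=> [C [CS [[A CA] _]] <-].
by have [x Ax] := ball_nonempty (CS _ CA); exists x, A.
Qed.

Definition cu_space (X : Type) (S : ball_space X) : ball_space X :=
  BallSpace (cu_nonempty S) (@cu_ball_nonempty X S).

Definition chain_union_stable (X : Type) (S : ball_space X) : Prop :=
  chain_union_closed (cu_space S).

Record ultrametric d (Gamma : bPOrderType d) (X : Type) := Ultrametric {
  udist :> X -> X -> Gamma;
  ultrametric_nonempty : [set: X] !=set0;
  udist_eq_bot : forall x y, udist x y = Order.bottom <-> x = y;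
  udist_trans : forall x y z (g : Gamma),
    (udist x y <= g)%O -> (udist y z <= g)%O -> (udist x z <= g)%O;
  udist_sym : forall x y, udist x y = udist y x
}.

Section UltrametricBalls.
Context d (Gamma : bPOrderType d) (X : Type) (u : ultrametric Gamma X).

Definition uball (x y : X) : set X := [set z | (u x z <= u x y)%O].

Definition uballs : set (set X) := [set B | exists x y, B = uball x y].

Lemma uballs_nonempty : uballs !=set0.
Proof. by have [x _] := ultrametric_nonempty u; exists (uball x x), x, x. Qed.

Lemma uball_nonempty (B : set X) : uballs B -> B !=set0.
Proof. by move=> [x [y ->]]; exists y; rewrite /uball /=. Qed.

Definition ultrametric_ball_space : ball_space X :=
  BallSpace uballs_nonempty uball_nonempty.

End UltrametricBalls.

(* Main.v *)
(* A set A is a chain union of balls iff it is nonempty and the balls contained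
   in A are directed by inclusion, a condition that passes to unions of chains:
   a ball, being the smallest ball around two of its points, lies in a member of
   the chain as soon as it lies in the union. For the "if" direction fix a point
   x of A. The balls around x inside A are determined by their radii, so they
   form a countable directed family, and such a family contains an increasing
   sequence with the same union. *)
Require Import Defs.
From mathcomp Require Import all_boot all_order.
From mathcomp Require Import boolp classical_sets functions cardinality.

Import Order.TTheory.
Local Open Scope classical_set_scope.

Definition directed {X : Type} (F : set (set X)) : Prop :=
  forall A B, F A -> F B -> exists C, [/\ F C, A `<=` C & B `<=` C].

Lemma chain_directed {X : Type} {C : set (set X)} : chain C -> directed C.
Proof.
by move=> [_ tC] A B CA CB; have [AB|BA] := tC _ _ CA CB;
  [exists B | exists A]; split.
Qed.

Lemma sub_cu (X : Type) (S : set (set X)) : S `<=` cu S.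
Proof.
move=> B SB; exists [set B]; last exact: bigcup_set1.
by split=> [_ ->//|]; split; [exists B | move=> _ _ -> ->; left].
Qed.

Lemma cuS {X : Type} {S T : set (set X)} : S `<=` T -> cu S `<=` cu T.
Proof. by move=> ST A [C [CS cC] <-]; exists C => //; split=> // B /CS /ST. Qed.

(** Enumerate [F] as [f] and choose recursively a member of [F] above the previous choice and the
    next [f n]; the resulting increasing sequence absorbs every member of [F]. *)
Lemma directed_countable_cu {X : Type} (F : set (set X)) :
  F !=set0 -> countable F -> directed F ->
  cu F (\bigcup_(B in F) B).
Proof.
move=> [B0 FB0] /pfcard_geP[F0|[f]] dirF.
  by move: FB0; rewrite F0.
have Ff n : F (f n) by exact: funS.
(* Choice needs a bound for every pair of sets; outside [F] the value [set0] is a dummy. *)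
have /choice[j jP] (p : set X * set X) : exists C, F p.1 -> F p.2 ->
    [/\ F C, p.1 `<=` C & p.2 `<=` C].
  case: (pselect (F p.1 /\ F p.2)) => [[F1 F2]|nF].
    by have [C ?] := dirF _ _ F1 F2; exists C.
  by exists set0 => F1 F2; case: nF.
pose a := fix a n := if n is m.+1 then j (a m, f m) else f 0.
have Fa n : F (a n).
  by elim: n => [|n Fan] /=; [exact: Ff | have [] := jP (a n, f n) Fan (Ff n)].
have aS n : a n `<=` a n.+1 by have [] := jP (a n, f n) (Fa n) (Ff n).
have fa n : f n `<=` a n.+1 by have [] := jP (a n, f n) (Fa n) (Ff n).
have a_mono m n : m <= n -> a m `<=` a n.
  by apply: (@homo_leq _ a subset _ _ aS) => [A|B A C AB BC x /AB /BC] //.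
exists (range a).
  split; first by move=> _ [n _ <-].
  split; first by exists (a 0), 0.
  move=> _ _ [m _ <-] [n _ <-].
  have [mn|/ltnW nm] := leqP m n; first by left; exact: a_mono.
  by right; exact: a_mono.
apply/seteqP; split=> x [B].
  by move=> [n _ <-] anx; exists (a n).
move=> FB Bx; have [n _ fnB] := @surj _ _ _ _ f _ FB.
by exists (a n.+1); [exists n.+1 | apply: fa; rewrite fnB].
Qed.

Section UltrametricBalls.
Context {d} {Gamma : bPOrderType d} {X : Type} (u : ultrametric Gamma X).

(** Every point of a ball is a center for the same radius. The right-hand side is not written with
    [uball]: in a partial order the radius [u x y] need not be a distance from [z]. *)
Lemma uball_recenter {x y z} :
  uball u x y z -> uball u x y = [set t | (u z t <= u x y)%O].
Proof.
move=> xz; apply/seteqP; split=> t /= h.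
  by apply: udist_trans h; rewrite udist_sym.
exact: udist_trans h.
Qed.

Lemma uball_center x y : uball u x y x.
Proof. by rewrite /uball /= (udist_eq_bot u x x).2 // le0x. Qed.

Lemma uball_boundary x y : uball u x y y.
Proof. by rewrite /uball /=. Qed.

Lemma uball_diag x : uball u x x = [set x].
Proof.
apply/seteqP; split=> y; last by move->; exact: uball_center.
rewrite /uball /= (udist_eq_bot u x x).2 // lex0.
by move=> /eqP/udist_eq_bot ->.
Qed.

(** Once [B] is recentered at [x], membership of [y] bounds [u x y] by the radius of [B]. *)
Lemma uball_min B x y : uballs u B -> B x -> B y -> uball u x y `<=` B.
Proof.
move=> [v [w ->]] /uball_recenter-> /= xy t.
by rewrite /uball /= => /le_trans; exact.
Qed.

Definition uballs_in (A : set X) : set (set X) :=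
  [set B | uballs u B /\ B `<=` A].

Definition uball_directed : set (set X) :=
  [set A | A !=set0 /\ directed (uballs_in A)].

(** Singletons are balls of radius bottom, so directedness can be applied to points. *)
Lemma uballs_in1 {A : set X} {x} : A x -> uballs_in A [set x].
Proof. by move=> Ax; split=> [|_ ->//]; exists x, x; rewrite uball_diag. Qed.

Lemma uballs_uball_directed : uballs u `<=` uball_directed.
Proof.
move=> B uB; split; first exact: uball_nonempty uB.
by move=> A1 A2 [_ A1B] [_ A2B]; exists B; split=> //; split.
Qed.

Lemma uball_directed_min {A : set X} {x y} :
  uball_directed A -> A x -> A y -> uball u x y `<=` A.
Proof.
move=> [_ dirA] Ax Ay.
have [B [[uB BA] xB yB]] := dirA _ _ (uballs_in1 Ax) (uballs_in1 Ay).
by apply: subset_trans BA; apply: uball_min => //; [exact: xB | exact: yB].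
Qed.

Lemma uball_sub_chain {C : set (set X)} {B} :
    C `<=` uball_directed -> chain C -> uballs_in (\bigcup_(A in C) A) B ->
  exists2 A, C A & B `<=` A.
Proof.
move=> Cdir cC [[x [y ->]] BC].
have [A1 C1 A1x] := BC _ (uball_center x y).
have [A2 C2 A2y] := BC _ (uball_boundary x y).
have [A [CA A1A A2A]] := chain_directed cC _ _ C1 C2.
exists A => //; apply: uball_directed_min (Cdir _ CA) _ _.
  exact: A1A.
exact: A2A.
Qed.

Lemma cu_uball_directed : cu uball_directed `<=` uball_directed.
Proof.
move=> _ [C [Cdir cC] <-]; split.
  by have [[A CA] _] := cC; have [[x Ax] _] := Cdir _ CA; exists x, A.
move=> B1 B2 B1C B2C.
have [A1 C1 BA1] := uball_sub_chain Cdir cC B1C.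
have [A2 C2 BA2] := uball_sub_chain Cdir cC B2C.
have [A [CA A1A A2A]] := chain_directed cC _ _ C1 C2.
have [|| B [[uB BA] B1B B2B]] := (Cdir _ CA).2 B1 B2.
- by split; [case: B1C | exact: subset_trans A1A].
- by split; [case: B2C | exact: subset_trans A2A].
by exists B; split=> //; split=> // t /BA At; exists A.
Qed.

Lemma uball_directed_cu :
  countable [set: Gamma] -> uball_directed `<=` cu (uballs u).
Proof.
move=> cGamma A [[x Ax] dirA].
(* Fixing a common point is what yields countability: [X] itself may be uncountable. *)
pose F := uballs_in A `&` [set B | B x].
have F_countable : countable F.
  apply: (@sub_countable _ _ _ [set: Gamma]) cGamma.
  (* Recentered at [x], each member of [F] is the image of its radius under this map. *)
  apply: card_le_trans (card_image_le (fun g => [set t | (u x t <= g)%O]) _).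
  apply: subset_card_le => _ [[[v [w ->]] _] /= Bx].
  by exists (u v w) => //; rewrite (uball_recenter Bx).
have F_directed : directed F.
  move=> B1 B2 [B1A B1x] [B2A _].
  have [B [BA B1B B2B]] := dirA _ _ B1A B2A.
  by exists B; split=> //; split=> //; exact: B1B.
have F_nonempty : F !=set0 by exists [set x]; split=> //; exact: uballs_in1.
have <- : \bigcup_(B in F) B = A.
  apply/seteqP; split=> [t [B [[_ BA] _]] /BA //|t At].
  have [B [BA xB tB]] := dirA _ _ (uballs_in1 Ax) (uballs_in1 At).
  by exists B; [split=> //; exact: xB | exact: tB].
have F_uballs : F `<=` uballs u by move=> B [[]].
apply: (cuS F_uballs).
exact: directed_countable_cu F_nonempty F_countable F_directed.
Qed.

End UltrametricBalls.

Theorem theorem1p5 (d : Order.disp_t) (Gamma : bPOrderType d) (X : Type)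
    (u : ultrametric Gamma X) (Gamma_countable : countable [set: Gamma]) :
  chain_union_stable (ultrametric_ball_space u).
Proof.
apply/seteqP; split; last exact: sub_cu.
(* Both applications of [cu] stay within the directed sets; countability serves only to return from
   there to [cu (uballs u)]. *)
have cu_dir : cu (uballs u) `<=` uball_directed u.
  by move=> A /(cuS (uballs_uball_directed u)) /cu_uball_directed.
move=> A /(cuS cu_dir) /cu_uball_directed.
exact: uball_directed_cu.
Qed.
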